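(* Assume that there are constants $0<c<C$ with $c\le Z\le C$, and that $\sum_{i=1}^\infty d_i^2<\infty$, where $d_i=\sup_{z\in[c,C]}|b_i(z)|$. Then $U_n\to U$ as $n\to\infty$, where $$U_n=\min_{h\in H_n}E\big[e^{-V(h)}\big],\qquad U=\inf_{h\in\bigcup_{n\ge1}H_n}E\big[e^{-V(h)}\big].$$
   Context: Let $(\varepsilon_i)_{i\ge1}$ be independent standard Gaussian random variables and $Z$ a positive random variable independent of $(\varepsilon_i)_{i\ge1}$. Let $\gamma_i,\mu_i\in\mathbb{R}$, $\bar\beta_i\in\mathbb{R}\setminus\{0\}$ ($i\ge1$) and $\beta_i\in\mathbb{R}$ ($i\ge2$) be constants. (They come from a market with zero risk-free rate and returns $R_1=\gamma_1Z+\mu_1+\bar\beta_1\sqrt{Z}\varepsilon_1$, $R_i=\gamma_iZ+\mu_i+\beta_i\sqrt{Z}\varepsilon_1+\bar\beta_i\sqrt{Z}\varepsilon_i$ for $i\ge2$.) For $z>0$ define $$b_1(z)=-\frac{\gamma_1\sqrt z}{\bar\beta_1}-\frac{\mu_1}{\sqrt z\,\bar\beta_1},\qquad b_i(z)=-\frac{\gamma_i\sqrt z}{\bar\beta_i}-\frac{\mu_i}{\sqrt z\,\bar\beta_i}-\frac{\beta_i b_1(z)}{\bar\beta_i}\quad(i\ge2).$$ $H_n$ is the set of all $n$-tuples $h=(h_1,\dots,h_n)$ of real numbers (identified with real sequences by appending zeros), and for $h\in H_n$, $V(h)=\sum_{i=1}^n h_i\sqrt{Z}\,(\varepsilon_i-b_i(Z))$;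 the random variables $V(h)$, $h\in H_n$, are exactly the portfolio returns $\sum_{i=1}^n\phi_iR_i$, $\phi\in\mathbb{R}^n$. *)

(* Defs.v *)
From HB Require Import structures.
From mathcomp Require Import all_boot all_order all_algebra.
From mathcomp Require Import all_classical all_reals all_analysis.

Set Implicit Arguments.
Unset Strict Implicit.
Unset Printing Implicit Defensive.

Import Order.TTheory GRing.Theory Num.Theory.
Import numFieldNormedType.Exports.

Local Open Scope classical_set_scope.
Local Open Scope ring_scope.

(* All sequences are indexed from 0: the index [i] here stands for the index  *)
(* [i + 1] of a sequence numbered from 1, so that asset 1 is [i = 0].         *)

Section independence.
Context {d : measure_display} {T : measurableType d} {R : realType}.
Variable P : probability T R.

Definition mutually_independent (X : nat -> {RV P >-> R}) : Prop :=
  forall (J : seq nat) (A : nat -> set R), uniq J ->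
    (forall i, measurable (A i)) ->
    P (\bigcap_(i in [set` J]) (X i @^-1` A i)) =
    (\prod_(i <- J) P (X i @^-1` A i))%E.

Definition sigma_of_sequence (X : nat -> {RV P >-> R}) : set (set T) :=
  <<s [set E | exists i (A : set R), measurable A /\ E = X i @^-1` A] >>.

Definition independent_of_sequence
    (Y : {RV P >-> R}) (X : nat -> {RV P >-> R}) : Prop :=
  forall (B : set R) (E : set T), measurable B -> sigma_of_sequence X E ->
    P ((Y @^-1` B) `&` E) = (P (Y @^-1` B) * P E)%E.

Definition standard_gaussian (X : {RV P >-> R}) : Prop :=
  forall A : set R, measurable A -> distribution P X A = normal_prob 0 1 A.

End independence.

Section market.
Context {R : realType}.
(* [barbeta i] is the coefficient of eps_i in the return of asset [i], and    *)
(* [beta i] that of eps_0; [beta 0] is never used.                            *)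
Variables gamma mu barbeta beta : nat -> R.

Definition bfun_first (z : R) : R :=
  - (gamma 0%N * Num.sqrt z / barbeta 0%N)
  - mu 0%N / (Num.sqrt z * barbeta 0%N).

Definition bfun (i : nat) (z : R) : R :=
  if i == 0%N then bfun_first z
  else - (gamma i * Num.sqrt z / barbeta i)
       - mu i / (Num.sqrt z * barbeta i)
       - beta i * bfun_first z / barbeta i.

Definition dsup (c C : R) (i : nat) : R :=
  sup [set `|bfun i z| | z in `[c, C]].

(* [n]-tuples, identified with real sequences by appending zeros. *)
Definition Hspace (n : nat) : set (nat -> R) :=
  [set h | forall i, (n <= i)%N -> h i = 0].

Context {d : measure_display} {T : measurableType d}.
Variables (P : probability T R) (Z : {RV P >-> R}) (eps : nat -> {RV P >-> R}).

(* The sum is over the finite support of the summand; [VE] below gives the    *)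
(* explicit sum when [h] is in [Hspace n].                                    *)
Definition V (h : nat -> R) (w : T) : R :=
  \sum_(i \in [set: nat]) h i * Num.sqrt (Z w) * (eps i w - bfun i (Z w)).

Lemma VE n h w : Hspace n h ->
  V h w = \sum_(i < n) h i * Num.sqrt (Z w) * (eps i w - bfun i (Z w)).
Proof.
move=> hn; pose F i := h i * Num.sqrt (Z w) * (eps i w - bfun i (Z w)).
rewrite /V (fsbig_ord _ _ F); apply/esym/fsbig_widen => // i [_ /negP].
by rewrite -leqNgt => ni; rewrite /F /= hn// !mul0r.
Qed.

Definition expected_disutility (h : nat -> R) : \bar R :=
  ('E_P[(fun w => expR (- V h w))])%E.

Definition Un (n : nat) : \bar R :=
  ereal_inf [set expected_disutility h | h in Hspace n].

Definition Uinf : \bar R :=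
  ereal_inf [set expected_disutility h |
             h in \bigcup_(n in [set n | (0 < n)%N]) Hspace n].

End market.

(* Main.v *)
(* For the minimum over H_n: by independence, with positive probability every *)
(* eps_i, i <= n, is far out on the side opposite to the sign of h_i. There   *)
(* - V(h) >= sqrt c * sum_i |h_i|, because Z >= c and the b_i are bounded on  *)
(* [c, C]; hence E[exp(- V(h))] is coercive in h. A minimizing sequence thus  *)
(* stays in a compact box, and Fatou's lemma applied along a convergent       *)
(* subsequence shows that its limit is a minimizer. The convergence U_n -> U  *)
(* is that of a nonincreasing sequence to its infimum.                        *)
Require Import Defs.
From mathcomp Require Import all_boot all_order all_algebra.
From mathcomp Require Import all_classical all_reals all_analysis.
From mathcomp Require Import measurable_realfun ring lra.
Import Order.TTheory GRing.Theory Num.Theory.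
Import numFieldNormedType.Exports.
Local Open Scope classical_set_scope.
Local Open Scope ring_scope.

(** The spaces H_n increase, so the U_n decrease to the infimum over their union ([Un_cvg]). The
    real content is that each U_n is attained ([disutility_min]), by the direct method:
    [disutility_coercive] confines a minimizing sequence to a box, [rV_bounded_subseq] extracts a
    limit, and lower semicontinuity ([disutility_le_liminf]) makes that limit a minimizer.
    Expectations may be infinite, so everything takes place in the extended reals. *)

Lemma measurable_inv (R : realType) : measurable_fun setT (@GRing.inv R).
Proof.
rewrite -(setvU [set 0 : R]); apply/measurable_funU.
- exact: measurableC.
- exact: measurable_set1.
split; last exact: measurable_fun_set1.
apply: open_continuous_measurable_fun.
  by rewrite openC; exact: closed_eq.
by move=> x /set_mem /= /eqP x0; exact: inv_continuous.
Qed.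

(** This common form removes the distinction between the first asset and the others: measurability
    and boundedness are both read off from it. *)
Lemma bfunE {R : realType} (gamma mu barbeta beta : nat -> R) (i : nat) :
  exists a m : R, forall z,
    bfun gamma mu barbeta beta i z = a * Num.sqrt z + m * (Num.sqrt z)^-1.
Proof.
rewrite /bfun /bfun_first; have [_|_] := eqVneq i 0%N.
  exists (- (gamma 0%N / barbeta 0%N)), (- (mu 0%N / barbeta 0%N)) => z.
  by rewrite invfM; ring.
exists (- (gamma i / barbeta i) + beta i * gamma 0%N / barbeta 0%N / barbeta i).
exists (- (mu i / barbeta i) + beta i * mu 0%N / barbeta 0%N / barbeta i) => z.
by rewrite !invfM; ring.
Qed.

Lemma measurable_bfun {R : realType} (gamma mu barbeta beta : nat -> R) i :
  measurable_fun setT (bfun gamma mu barbeta beta i).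
Proof.
have [a [m bE]] := bfunE gamma mu barbeta beta i.
have msqrt : measurable_fun setT (@Num.sqrt R).
  by apply: continuous_measurable_fun; exact: sqrt_continuous.
rewrite (funext bE); apply: measurable_funD; apply: measurable_funM => //.
by apply: measurableT_comp => //; exact: measurable_inv.
Qed.

(** The square root is largest at C and its inverse largest at c, which is positive. *)
Lemma bfun_bounded {R : realType} (gamma mu barbeta beta : nat -> R) (c C : R) i :
  0 < c -> exists M, forall z, c <= z <= C ->
    `|bfun gamma mu barbeta beta i z| <= M.
Proof.
move=> c0; have [a [m bE]] := bfunE gamma mu barbeta beta i.
exists (`|a| * Num.sqrt C + `|m| * (Num.sqrt c)^-1) => z /andP[cz zC].
have z0 : 0 < z by exact: lt_le_trans cz.
rewrite bE (le_trans (ler_normD _ _))// !normrM lerD//.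
  by rewrite (ger0_norm (sqrtr_ge0 _)) ler_wpM2l// ler_wsqrtr.
rewrite normfV (ger0_norm (sqrtr_ge0 _)) ler_wpM2l//.
by rewrite lef_pV2 ?posrE ?sqrtr_gt0// ler_wsqrtr.
Qed.

(** The density is positive everywhere, so a zero integral over A would make A a Lebesgue null
    set. *)
Lemma normal_prob_gt0 {R : realType} (m s : R) (A : set R) : s != 0 ->
  measurable A -> (0 < lebesgue_measure A)%E -> (0 < normal_prob m s A)%E.
Proof.
move=> s0 mA A0.
have npdf_gt0 x : 0 < normal_pdf m s x.
  by rewrite normal_pdfE// mulr_gt0// ?expR_gt0// normal_peak_gt0.
rewrite lt0e; apply/andP; split; last first.
  by apply: integral_ge0 => x _; rewrite lee_fin normal_pdf_ge0.
apply/eqP => I0.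
have /ae_eq_integral_abs : (\int[lebesgue_measure]_(x in A)
    `|(normal_pdf m s x)%:E| = 0)%E.
  by rewrite -[RHS]I0; apply: eq_integral => x _; rewrite gee0_abs// lee_fin ltW.
case.
- exact: mA.
- by apply/measurable_EFinP; apply: measurable_funTS; exact: measurable_normal_pdf.
move=> N [mN N0 AN].
have : (lebesgue_measure A <= lebesgue_measure N)%E.
  apply: le_measure; rewrite ?inE// => x Ax; apply: AN => /= /(_ Ax) [] /eqP.
  by rewrite gt_eqF.
by rewrite N0 leNgt A0.
Qed.

(** Bolzano-Weierstrass, from a cluster point of the compact box. Instead of strict monotonicity of
    [s] one asks only [k <= s k], which already sends [s k] to infinity. *)
Lemma rV_bounded_subseq {R : realType} n (M : R) (u : nat -> 'rV[R]_n) :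
  (forall k i, `|u k ord0 i| <= M) ->
  exists (v : 'rV[R]_n) (s : nat -> nat), (forall k, (k <= s k)%N) /\
    forall i, u (s k) ord0 i @[k --> \oo] --> v ord0 i.
Proof.
move=> uM.
have [|v [_ vcl]] := @rV_compact R n _ (fun=> @segment_compact R (- M) M) (u @ \oo) _.
  by exists 0%N => // k _ i; rewrite /= in_itv/= -ler_norml.
have /choice[s sP] : forall k, exists m, (k <= m)%N /\
    forall i, `|v ord0 i - u m ord0 i| < k.+1%:R^-1.
  move=> k.
  have [||_ [[m km <-] [_ vm]]] := vcl (u @` [set m | (k <= m)%N]) (ball v k.+1%:R^-1).
  - by exists k => // m /= km; exists m.
  - by apply: nbhsx_ballx; rewrite invr_gt0.
  by exists m; split => // i; exact: vm.
exists v, s; split=> [k|i]; first by have [] := sP k.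
apply/cvgrPdist_lt => e e0; near=> k.
have [_ /(_ i) vk] := sP k; apply: lt_trans vk _.
by near: k; exact: near_infty_natSinv_lt (PosNum e0).
Unshelve. all: by end_near. Qed.

Lemma standard_gaussian_gt0 {d} {T : measurableType d} {R : realType}
    (P : probability T R) (X : {RV P >-> R}) (A : set R) :
  standard_gaussian X -> measurable A -> (0 < lebesgue_measure A)%E ->
  (0 < P (X @^-1` A))%E.
Proof.
move=> gX mA A0; have := gX A mA.
rewrite /distribution /pushforward => ->.
by apply: normal_prob_gt0; rewrite ?oner_eq0.
Qed.

Lemma prodEFin_le {R : realType} (s : seq nat) (q : nat -> R) (F : nat -> \bar R) :
  (forall i, 0 <= q i) -> (forall i, ((q i)%:E <= F i)%E) ->
  ((\prod_(i <- s) q i)%:E <= \prod_(i <- s) F i)%E.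
Proof.
move=> q0 qF; elim: s => [|i s IH]; first by rewrite !big_nil.
by rewrite !big_cons EFinM; apply: lee_pmul => //; rewrite lee_fin// prodr_ge0.
Qed.

Section disutility.
Context {R : realType} {d : measure_display} {T : measurableType d}.
Variables (P : probability T R) (gamma mu barbeta beta : nat -> R).
Variables (Z : {RV P >-> R}) (eps : nat -> {RV P >-> R}).

Local Notation b := (bfun gamma mu barbeta beta).
Local Notation W := (V gamma mu barbeta beta Z eps).
Local Notation f := (expected_disutility gamma mu barbeta beta Z eps).

Lemma measurable_disutility n h : Hspace n h ->
  measurable_fun setT (fun w => (expR (- W h w))%:E).
Proof.
move=> hn; apply/measurable_EFinP; apply: measurableT_comp => //.
apply: measurableT_comp => //; have -> : W h = (fun w =>
    \sum_(i < n) h i * Num.sqrt (Z w) * (eps i w - b i (Z w))).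
  by apply/funext => w; exact: VE.
apply: measurable_sum => i; apply: measurable_funM; last first.
  apply: measurable_funB => //.
  by apply: measurableT_comp => //; exact: measurable_bfun.
apply: measurable_funM => //.
apply: measurableT_comp => //; apply: continuous_measurable_fun.
exact: sqrt_continuous.
Qed.

Lemma disutilityE h : f h = (\int[P]_w (expR (- W h w))%:E)%E.
Proof. by rewrite /expected_disutility unlock. Qed.

Lemma disutility_ge0 h : (0 <= f h)%E.
Proof.
by rewrite disutilityE; apply: integral_ge0 => w _; rewrite lee_fin expR_ge0.
Qed.

Hypothesis eps_gauss : forall i, standard_gaussian (eps i).
Hypothesis eps_indep : mutually_independent eps.
Variables c C : R.
Hypothesis c_gt0 : 0 < c.
Hypothesis Z_bounds : {ae P, forall w, c <= Z w <= C}.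

(** The constant p must not depend on h, whereas the favourable event depends on the signs of the
    h_i; taking for each i the less likely of the two tails settles this. *)
Lemma disutility_coercive n : exists2 p : R, 0 < p & forall h, Hspace n h ->
  ((p * expR (Num.sqrt c * \sum_(i < n) `|h i|))%:E <= f h)%E.
Proof.
have /choice[M bM] : forall i, exists M : R, forall z, c <= z <= C -> `|b i z| <= M.
  by move=> i; exact: bfun_bounded.
(* The flag [s] records [0 <= h i]. Beyond the threshold M_i + 1, eps_i - b_i(Z) has absolute value
   at least 1 and the sign opposite to h_i, so -h_i (eps_i - b_i(Z)) >= |h_i|. *)
pose A (s : bool) i : set R :=
  if s then `]-oo, (- (M i + 1))[%classic else `](M i + 1), +oo[%classic.
have mA s i : measurable (A s i) by rewrite /A; case: s.
have A_gt0 s i : (0 < P (eps i @^-1` A s i))%E.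
  apply: standard_gaussian_gt0 => //.
  by rewrite /A; case: s; rewrite lebesgue_measure_itv/= ?ltNyr ?ltry.
have Pfin s i : P (eps i @^-1` A s i) \is a fin_num.
  apply: fin_num_measure.
  by rewrite -[X in measurable X]setTI; exact: measurable_funP.
pose q i := Num.min (fine (P (eps i @^-1` A true i)))
                    (fine (P (eps i @^-1` A false i))).
have q_gt0 i : 0 < q i by rewrite lt_min !fine_gt0// A_gt0 ltey_eq Pfin.
exists (\prod_(i <- iota 0 n) q i); first by apply: prodr_gt0 => i _.
move=> h hn.
pose E := \bigcap_(i in [set` iota 0 n]) (eps i @^-1` A (0 <= h i) i).
have mE : measurable E.
  apply: fin_bigcap_measurable => // i _.
  by rewrite -[X in measurable X]setTI; exact: measurable_funP.
have PE : ((\prod_(i <- iota 0 n) q i)%:E <= P E)%E.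
  rewrite /E eps_indep ?iota_uniq//.
  apply: prodEFin_le => i; first exact: ltW.
  rewrite -(fineK (Pfin _ _)) lee_fin /q.
  by case: (0 <= h i); rewrite ge_min lexx ?orbT.
rewrite disutilityE; set t := Num.sqrt c * _.
apply: (@le_trans _ _ (\int[P]_(w in E) (expR (- W h w))%:E)%E); last first.
  by apply: ge0_subset_integral => //; exact: (measurable_disutility _ _ hn).
apply: (@le_trans _ _ (\int[P]_(w in E) (cst (expR t)%:E w))%E).
  by rewrite integral_cst// mulrC EFinM lee_wpmul2l.
(* The comparison of integrands is only almost sure, because the bounds on Z are. *)
apply: ae_ge0_le_integral => //.
- by move=> w _; rewrite lee_fin expR_ge0.
- by apply: measurable_funTS; exact: (measurable_disutility _ _ hn).
apply: filterS Z_bounds => w Zw Ew; rewrite lee_fin ler_expR (VE _ _ _ _ _ _ _ hn).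
have [cZ ZC] := andP Zw.
rewrite /t mulr_sumr -sumrN; apply: ler_sum => i _.
have Ai : A (0 <= h i) i (eps i w) by apply: Ew; rewrite /= mem_iota/= add0n.
rewrite -mulrN mulrAC [leRHS]mulrC.
have : `|h i| <= h i * - (eps i w - b i (Z w)).
  have := bM i _ Zw; rewrite ler_norml => /andP[b1 b2].
  move: Ai; rewrite /A; case: (leP 0 (h i)) => h0; rewrite /= in_itv/= ?andbT => ei.
    by rewrite ger0_norm// ler_peMr//; lra.
  by rewrite ltr0_norm//; nra.
by move=> hi; apply: ler_pM => //; rewrite ler_wsqrtr.
Qed.

(** Fatou applies because the integrands are nonnegative; for a fixed outcome, V is a finite sum,
    hence continuous in the coordinates of h. *)
Lemma disutility_le_liminf n (u : nat -> nat -> R) (g : nat -> R) :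
  (forall k, Hspace n (u k)) -> Hspace n g ->
  (forall i, u k i @[k --> \oo] --> g i) ->
  (f g <= limn_einf (fun k => f (u k)))%E.
Proof.
move=> un gn ug.
under [X in limn_einf X]eq_fun do rewrite disutilityE.
have mfu k := measurable_disutility _ _ (un k).
apply: le_trans (fatou P measurableT mfu _); last first.
  by move=> k w _; rewrite lee_fin expR_ge0.
(* The two integrals are equal: the integrands converge pointwise, so their lower limit is the
   limit. *)
rewrite disutilityE le_eqVlt; apply/orP; left; apply/eqP.
apply: eq_integral => w _; apply/esym.
apply: (cvg_limn_einf_sup _).1; apply: cvg_EFin; first exact: nearW.
apply: continuous_cvg; first exact: continuous_expR.
apply: cvgN; rewrite (VE _ _ _ _ _ _ _ gn).
under eq_fun do rewrite (VE _ _ _ _ _ _ _ (un _)).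
apply: cvg_big => [|i _]; first exact: add_continuous.
by apply: cvgM; [apply: cvgM; [exact: ug | exact: cvg_cst] | exact: cvg_cst].
Qed.

(** The zero portfolio shows that U_n is at most 1, hence finite. *)
Lemma disutility0 : f (fun=> 0) = 1%E.
Proof.
have V0 w : W (fun=> 0) w = 0.
  by rewrite (@VE _ _ _ _ _ _ _ _ _ _ 0%N) ?big_ord0.
rewrite disutilityE; under eq_integral do rewrite V0 oppr0 expR0.
by rewrite integral_cst// mul1e; exact: probability_setT.
Qed.

Lemma disutility_min n : exists2 h, Hspace n h &
  f h = Un gamma mu barbeta beta Z eps n.
Proof.
set U := Un _ _ _ _ _ _ _.
have U_le h : Hspace n h -> (U <= f h)%E.
  by move=> hn; apply: ereal_inf_lbound; exists h.
have U0 : (0 <= U)%E.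
  by apply: le_ereal_inf_tmp => _ [h _ <-]; exact: disutility_ge0.
have Ufin : U \is a fin_num.
  rewrite ge0_fin_numE//; apply: (@le_lt_trans _ _ 1%E); last by rewrite ltry.
  by rewrite -disutility0; exact: U_le.
have /choice[u uP] : forall k, exists h, Hspace n h /\
    (f h < U + (k.+1%:R^-1)%:E)%E.
  move=> k; have k0 : 0 < (k.+1%:R^-1 : R) by rewrite invr_gt0.
  by have [_ [h hn <-] hU] := lb_ereal_inf_adherent k0 Ufin; exists h.
have [p p0 fp] := disutility_coercive n.
(* Since t <= exp t, coercivity gives p sqrt(c) |h_i| <= f(h), and f(h) <= U + 1 along the
   minimizing sequence. *)
pose M := (fine U + 1) / p / Num.sqrt c.
have uM k i : `|(\row_(i < n) u k i) ord0 i| <= M.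
  have [hn hU] := uP k; rewrite mxE /M ler_pdivlMr ?sqrtr_gt0// ler_pdivlMr//.
  apply: (@le_trans _ _ (p * expR (Num.sqrt c * \sum_(i < n) `|u k i|))).
    rewrite mulrC ler_wpM2l ?(ltW p0)// mulrC.
    apply: (@le_trans _ _ (Num.sqrt c * \sum_(i < n) `|u k i|)).
      rewrite ler_wpM2l ?sqrtr_ge0// (bigD1 i)//= lerDl.
      by apply: sumr_ge0.
    by apply: le_trans (expR_ge1Dx _); rewrite lerDr.
  rewrite -lee_fin; apply: le_trans (fp _ hn) _; apply: le_trans (ltW hU) _.
  rewrite EFinD fineK// leeD2l// lee_fin invf_le1//.
  by rewrite ler1n.
have [v [s [ks sv]]] := rV_bounded_subseq _ _ _ uM.
(* The limit row vector, extended by zeros to a sequence in H_n. *)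
pose g i := oapp (v ord0) 0 (insub i).
have gn : Hspace n g.
  by move=> i ni; rewrite /g insubN// -leqNgt.
exists g => //; apply/eqP; rewrite eq_le U_le// andbT.
apply: le_trans (@disutility_le_liminf n (u \o s) g _ gn _) _.
- by move=> k; have [] := uP (s k).
- move=> i; rewrite /g; case: insubP => [j _ <-|ni] /=.
    by have := sv j; under eq_fun do rewrite mxE.
  have -> : (fun k => (u \o s) k i) = cst 0; last exact: cvg_cst.
  by apply/funext => k; apply: (uP _).1; rewrite leqNgt.
have -> : limn_einf (fun k => f ((u \o s) k)) = U; last by [].
apply: (cvg_limn_einf_sup _).1.
(* The excess over U at index [s k] is below 1/(s k + 1), hence at most 1/(k + 1) because
   [k <= s k]. *)
apply: (@squeeze_cvge _ _ _ _ (fun=> U) _ (fun k => U + (k.+1%:R^-1)%:E)%E).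
- apply: nearW => k; have [hn hU] := uP (s k); rewrite U_le//=.
  apply: le_trans (ltW hU) _; rewrite leeD2l// lee_fin lef_pV2 ?posrE//.
  by rewrite ler_nat ltnS.
- exact: cvg_cst.
rewrite -[X in _ --> X]adde0; apply: cvgeD; first by rewrite fin_num_adde_defl.
  exact: cvg_cst.
by apply: cvg_EFin; [exact: nearW | exact: cvg_harmonic].
Qed.

Lemma Un_cvg : Un gamma mu barbeta beta Z eps @ \oo -->
  Uinf gamma mu barbeta beta Z eps.
Proof.
have Hle m n : (m <= n)%N -> Hspace m `<=` @Hspace R n.
  by move=> mn h hm i ni; apply: hm; exact: leq_trans ni.
have Ule : {homo Un gamma mu barbeta beta Z eps : m n / (m <= n)%N >-> (n <= m)%E}.
  move=> m n mn; apply: le_ereal_inf_tmp => _ [h hm <-].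
  by apply: ereal_inf_lbound; exists h => //; exact: Hle hm.
suff <- : ereal_inf (range (Un gamma mu barbeta beta Z eps)) =
    Uinf gamma mu barbeta beta Z eps.
  exact: ereal_nonincreasing_cvgn.
apply/eqP; rewrite eq_le; apply/andP; split; apply: le_ereal_inf_tmp.
  move=> _ [h [n _ hn] <-].
  apply: (@le_trans _ _ (Un gamma mu barbeta beta Z eps n)).
    by apply: ereal_inf_lbound; exists n.
  by apply: ereal_inf_lbound; exists h.
(* The range of U_n includes n = 0 while the union in [Uinf] starts at n = 1; passing from H_n to
   H_{n+1} bridges the gap. *)
move=> _ [n _ <-]; apply: le_ereal_inf_tmp => _ [h hn <-].
by apply: ereal_inf_lbound; exists h => //; exists n.+1 => //; exact: Hle hn.
Qed.

End disutility.

Theorem theorem3p3 (R : realType) (d : measure_display) (T : measurableType d)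
  (P : probability T R)
  (eps : nat -> {RV P >-> R}) (Z : {RV P >-> R})
  (gamma mu barbeta beta : nat -> R) (c C : R)
  (eps_gauss : forall i, standard_gaussian (eps i))
  (eps_indep : mutually_independent eps)
  (Z_indep : independent_of_sequence Z eps)
  (Z_pos : {ae P, forall w, 0 < Z w})
  (barbeta_neq0 : forall i, barbeta i != 0)
  (c_gt0 : 0 < c) (c_lt_C : c < C)
  (Z_bounds : {ae P, forall w, c <= Z w <= C})
  (d_summable :
    (\sum_(0 <= i <oo) ((dsup gamma mu barbeta beta c C i) ^+ 2)%:E < +oo)%E) :
  (forall n, (0 < n)%N ->
     exists2 h, Hspace n h &
       expected_disutility gamma mu barbeta beta Z eps h
       = Un gamma mu barbeta beta Z eps n) /\
  Un gamma mu barbeta beta Z eps @ \oo --> Uinf gamma mu barbeta beta Z eps.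
Proof.
split=> [n _|]; last exact: Un_cvg.
exact: (disutility_min _ _ _ _ _ _ _ eps_gauss eps_indep c C c_gt0 Z_bounds).
Qed.
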